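(* Let $X$ be a Banach lattice and let $(E_n)_{n\ge1}$ be a contractive filtration on $X$ such that $E_n$ is a band projection for every $n$. Then the space $M_X=M_X(X,(E_n))$ of all bounded $X$-martingales with respect to $(E_n)$, with the supremum norm and the coordinate-wise order, is a Banach lattice with coordinate-wise lattice operations.
   Context: A contractive filtration on a normed lattice $X$ is a sequence $(E_n)_{n\ge1}$ of positive linear projections on $X$ (i.e. $E_n^2=E_n$ and $E_nx\ge0$ whenever $x\ge0$) which are contractive ($\|E_nx\|\le\|x\|$ for all $x\in X$) and satisfy $E_nE_m=E_{\min(n,m)}$ for all $n,m$. A band projection is the projection onto a band $Y$ along its disjoint complement $Y^d$, where $X=Y\oplus Y^d$. A sequence $(x_n)_{n\ge1}$ in $X$ is an $X$-martingale with respect to $(E_n)$ if $\lim_{n\to\infty}\sup_{m\ge n}\|E_nx_m-x_n\|=0$. A sequence $A=(x_n)$ is bounded if $\|A\|:=\sup_n\|x_n\|<\infty$; this supremum is the norm on $M_X$. The coordinate-wise order is: $(x_n)\ge(y_n)$ iff $x_n\ge y_n$ for every $n$. Coordinate-wise lattice operations means $(x_n)\vee(y_n)=(x_n\vee y_n)$, $(x_n)\wedge(y_n)=(x_n\wedge y_n)$, and $|(x_n)|=(|x_n|)$. *)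

(* Defs.v *)
From HB Require Import structures.
From mathcomp Require Import all_boot all_order all_algebra.
From mathcomp Require Import all_classical all_reals all_analysis.

Set Implicit Arguments.
Unset Strict Implicit.
Unset Printing Implicit Defensive.

Import Order.TTheory GRing.Theory Num.Theory.
Import numFieldNormedType.Exports.

Local Open Scope classical_set_scope.
Local Open Scope ring_scope.

(* HB rejects structures below both Lmodule and Order.Lattice: the existing join
   of their parents is the numeric realDomainType.  The lattice order is
   therefore stored as a class of Order.Lattice on the carrier, and
   [lattice_of X] is the latticeType with the same elements as X. *)
HB.mixin Record Lmodule_isVectorLattice (R : realType) X
    & GRing.Lmodule R X := {
  lattice_class : Order.Lattice.axioms_ ring_display X ;
  vlat_leD2r : forall x y z : X,
    @Order.le _ (Order.Lattice.Pack lattice_class) x y ->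
    @Order.le _ (Order.Lattice.Pack lattice_class) (x + z) (y + z) ;
  vlat_leZ2l : forall (a : R) (x y : X), 0 <= a ->
    @Order.le _ (Order.Lattice.Pack lattice_class) x y ->
    @Order.le _ (Order.Lattice.Pack lattice_class) (a *: x) (a *: y)
}.

#[short(type="vectorLatticeType")]
HB.structure Definition VectorLattice (R : realType) :=
  {X of GRing.Lmodule R X & Lmodule_isVectorLattice R X}.

Definition lattice_of (R : realType) (X : vectorLatticeType R) :
    latticeType ring_display :=
  Order.Lattice.Pack (@lattice_class R X).

Section VectorLatticeOperations.
Context (R : realType) (X : vectorLatticeType R).

Definition vle (x y : X) : bool := @Order.le _ (lattice_of X) x y.
Definition vjoin (x y : X) : X := @Order.join _ (lattice_of X) x y.
Definition vmeet (x y : X) : X := @Order.meet _ (lattice_of X) x y.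

(* The modulus, with values in X; `|x| is the norm. *)
Definition vabs (x : X) : X := vjoin x (- x).

End VectorLatticeOperations.

HB.mixin Record NormedModule_isNormedLattice (R : realType) X
    & NormedModule R X & VectorLattice R X := {
  norm_le_vabs : forall x y : X, vle (vabs x) (vabs y) -> `|x| <= `|y|
}.

#[short(type="normedLatticeType")]
HB.structure Definition NormedLattice (R : realType) :=
  {X of NormedModule R X & VectorLattice R X & NormedModule_isNormedLattice R X}.

#[short(type="banachLatticeType")]
HB.structure Definition BanachLattice (R : realType) :=
  {X of CompleteNormedModule R X & NormedLattice R X}.

Section Bands.
Context (R : realType) (X : vectorLatticeType R).

Definition disjoint_complement (Y : set X) : set X :=
  [set x | forall y, Y y -> vmeet (vabs x) (vabs y) = 0].

Record is_band (Y : set X) : Prop := IsBand {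
  band0 : Y 0 ;
  bandD : forall x y, Y x -> Y y -> Y (x + y) ;
  bandZ : forall (a : R) x, Y x -> Y (a *: x) ;
  band_solid : forall x y, vle (vabs x) (vabs y) -> Y y -> Y x ;
  band_sup : forall (D : set X) (s : X),
    D !=set0 -> D `<=` Y -> isLub (D : set (lattice_of X)) s -> Y s
}.

(* X is the sum of Y and Y^d, and P (y + z) = y for y in Y and z in Y^d; the
   sum is direct since Y and Y^d meet only in 0. *)
Definition is_band_projection (P : X -> X) : Prop :=
  exists Y : set X,
    [/\ is_band Y,
        forall x, exists y z, [/\ Y y, disjoint_complement Y z & x = y + z]
      & forall y z, Y y -> disjoint_complement Y z -> P (y + z) = y].

End Bands.

Section Martingales.
Context (R : realType) (X : normedLatticeType R).

(* Filtrations and sequences are indexed from 0 instead of 1; the shift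
   commutes with [minn]. *)
Record is_contractive_filtration (E : nat -> {linear X -> X}) : Prop :=
  IsContractiveFiltration {
  filtration_idem : forall n x, E n (E n x) = E n x ;
  filtration_pos : forall n x, vle 0 x -> vle 0 (E n x) ;
  filtration_contractive : forall n x, `|E n x| <= `|x| ;
  filtration_min : forall n m x, E n (E m x) = E (minn n m) x
}.

(* The suprema are taken in \bar R, as they may be infinite. *)
Definition is_martingale (E : nat -> {linear X -> X}) (x : nat -> X) : Prop :=
  (fun n => ereal_sup [set (`|E n (x m) - x n|)%:E | m in [set m | (n <= m)%N]])
    @ \oo --> (0 : \bar R).

Definition sup_norm (x : nat -> X) : \bar R :=
  ereal_sup (range (fun n => (`|x n|)%:E)).

Definition bounded_martingale (E : nat -> {linear X -> X}) : set (nat -> X) :=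
  [set x | is_martingale E x /\ (sup_norm x < +oo)%E].

(* Only the set of elements of M_X, as a type. *)
Definition martingale_space (E : nat -> {linear X -> X}) : Type :=
  set_type (bounded_martingale E).

Definition mart_seq (E : nat -> {linear X -> X}) (A : martingale_space E) :
  nat -> X := \val A.

End Martingales.

(* The type of Banach lattice structures with carrier T. *)
Notation banach_lattice_on R T := (BanachLattice.axioms_ R T).

(* Main.v *)
(* A band projection P commutes with the modulus: if x = y + z with y in the
   band and z disjoint from it, then |x| = |y| + |z|, so P|x| = |y| = |Px|.
   Since ||u| - |v|| <= |u - v|, this yields
   ‖E_n |x_m| - |x_n|‖ <= ‖E_n x_m - x_n‖,
   and bounded martingales are stable under coordinate-wise moduli, hence under
   joins x ∨ y = (x + y + |x - y|) / 2 and meets.  Completeness needs only the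
   contractivity of the E_n: a Cauchy filter of martingales converges uniformly
   in n, and a uniform limit of martingales is one by a three-epsilon bound. *)

Require Import Defs.
From HB Require Import structures.
From mathcomp Require Import all_boot all_order all_algebra.
From mathcomp Require Import all_classical all_reals all_analysis.
From mathcomp Require Import ring.

Set Implicit Arguments.
Unset Strict Implicit.
Unset Printing Implicit Defensive.

Import Order.TTheory GRing.Theory Num.Theory.
Import numFieldNormedType.Exports.

Local Open Scope classical_set_scope.
Local Open Scope ring_scope.

Lemma scale_half_double (F : numFieldType) (V : lmodType F) (v : V) :
  2^-1 *: (v + v) = v.
Proof. by rewrite -[v in v + v]scale1r -scalerDl scalerA mulVf ?scale1r. Qed.

(** * Vector lattice identities, the modulus, and band projections *)

Section VectorLatticeTheory.
Context (R : realType) (X : vectorLatticeType R).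
Implicit Types (x y z t : X) (a : R).

Lemma vle_refl x : vle x x.
Proof. exact: lexx. Qed.

Lemma vle_trans y x z : vle x y -> vle y z -> vle x z.
Proof. exact: le_trans. Qed.

Lemma vle_anti x y : vle x y -> vle y x -> x = y.
Proof.
by move=> xy yx; apply: (@le_anti _ (lattice_of X)); apply/andP; split.
Qed.

Lemma vleUx x y z : vle (vjoin x y) z = vle x z && vle y z.
Proof. exact: (@leUx _ (lattice_of X)). Qed.

Lemma vlexI x y z : vle z (vmeet x y) = vle z x && vle z y.
Proof. exact: (@lexI _ (lattice_of X)). Qed.

Lemma vle_joinl x y : vle x (vjoin x y).
Proof. exact: (@leUl _ (lattice_of X)). Qed.

Lemma vle_joinr x y : vle y (vjoin x y).
Proof. exact: (@leUr _ (lattice_of X)). Qed.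

Lemma vle_meetl x y : vle (vmeet x y) x.
Proof. exact: (@leIl _ (lattice_of X)). Qed.

Lemma vle_meetr x y : vle (vmeet x y) y.
Proof. exact: (@leIr _ (lattice_of X)). Qed.

Lemma vleDr z x y : vle x y -> vle (x + z) (y + z).
Proof. exact: vlat_leD2r. Qed.

Lemma vleZ a x y : 0 <= a -> vle x y -> vle (a *: x) (a *: y).
Proof. exact: vlat_leZ2l. Qed.

Lemma vleD x y z t : vle x y -> vle z t -> vle (x + z) (y + t).
Proof.
move=> xy zt; apply: (@vle_trans (y + z)); first exact: vleDr.
by rewrite ![y + _]addrC; exact: vleDr.
Qed.

Lemma vleN x y : vle x y -> vle (- y) (- x).
Proof.
move=> /(@vleDr (- x - y)).
by rewrite addrA subrr add0r [- x - y]addrC addrA subrr add0r.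
Qed.

(** Translation by [z] is monotone with monotone inverse, so the nontrivial inequality follows by
    translating back. *)
Lemma vjoinDr x y z : vjoin (x + z) (y + z) = vjoin x y + z.
Proof.
apply: vle_anti; first by rewrite vleUx !vleDr ?vle_joinl ?vle_joinr.
rewrite -[vjoin (_ + _) _](subrK z).
apply: vleDr; rewrite vleUx; apply/andP; split.
  by rewrite -{1}(addrK z x); apply: vleDr; apply: vle_joinl.
by rewrite -{1}(addrK z y); apply: vleDr; apply: vle_joinr.
Qed.

Lemma vjoinZ a x y : 0 < a -> vjoin (a *: x) (a *: y) = a *: vjoin x y.
Proof.
move=> a0; have a0' := ltW a0; have a1 := lt0r_neq0 a0.
apply: vle_anti; first by rewrite vleUx !vleZ ?vle_joinl ?vle_joinr.
rewrite -[vjoin (_ *: _) _](scalerKV a1); apply: vleZ => //.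
have ai0 : 0 <= a^-1 by rewrite invr_ge0.
rewrite vleUx; apply/andP; split.
  by rewrite -{1}(scalerK a1 x); apply: vleZ => //; apply: vle_joinl.
by rewrite -{1}(scalerK a1 y); apply: vleZ => //; apply: vle_joinr.
Qed.

Lemma vmeetN x y : vmeet x y = - vjoin (- x) (- y).
Proof.
apply: vle_anti.
  rewrite -[vmeet _ _]opprK; apply: vleN.
  by rewrite vleUx !vleN ?vle_meetl ?vle_meetr.
rewrite vlexI -{2}[x]opprK -{3}[y]opprK.
by rewrite !vleN ?vle_joinl ?vle_joinr.
Qed.

Lemma vjoinC x y : vjoin x y = vjoin y x.
Proof. exact: (@joinC _ (lattice_of X)). Qed.

Lemma vmeetC x y : vmeet x y = vmeet y x.
Proof. exact: (@meetC _ (lattice_of X)). Qed.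

(** Translating the join of [- x] and [- y] by [x + y] gives the join of [y] and [x]; by [vmeetN]
    the former join is the opposite of the meet. *)
Lemma vjoin_meet x y : vjoin x y + vmeet x y = x + y.
Proof.
rewrite vmeetN; apply/eqP; rewrite subr_eq addrC vjoinC -vjoinDr.
by rewrite addrA addNr add0r addrCA addNr addr0 vjoinC.
Qed.

(** Translating [x - y] and [y - x] by [x + y] yields [x + x] and [y + y], and halving commutes with
    joins. *)
Lemma vjoinE x y : vjoin x y = 2^-1 *: (x + y + vabs (x - y)).
Proof.
rewrite /vabs [X in _ *: X]addrC -vjoinDr opprB -vjoinZ ?invr_gt0 ?ltr0n//.
rewrite addrACA addNr addr0 [x + y]addrC addrACA addNr addr0.
by rewrite !scale_half_double.
Qed.

Lemma vabs_le x y : vle (vabs x) y = vle x y && vle (- x) y.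
Proof. exact: vleUx. Qed.

Lemma vle_vabs x : vle x (vabs x).
Proof. exact: vle_joinl. Qed.

Lemma vleN_vabs x : vle (- x) (vabs x).
Proof. exact: vle_joinr. Qed.

Lemma vabsN x : vabs (- x) = vabs x.
Proof. by rewrite /vabs opprK vjoinC. Qed.

Lemma vabs_ge0 x : vle 0 (vabs x).
Proof.
have := vleD (vle_vabs x) (vleN_vabs x); rewrite subrr.
move=> /(@vleZ 2^-1); rewrite invr_ge0 ler0n scaler0 => /(_ isT).
by rewrite scale_half_double.
Qed.

Lemma vabs_id x : vle 0 x -> vabs x = x.
Proof.
move=> x0; apply: vle_anti; last exact: vle_vabs.
rewrite vabs_le vle_refl /=; apply: (@vle_trans 0) => //.
by rewrite -oppr0; exact: vleN.
Qed.

Lemma vabs_vabs x : vabs (vabs x) = vabs x.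
Proof. exact/vabs_id/vabs_ge0. Qed.

Lemma vabsD x y : vle (vabs (x + y)) (vabs x + vabs y).
Proof.
rewrite vabs_le opprD; apply/andP; split; apply: vleD;
  by [exact: vle_vabs | exact: vleN_vabs].
Qed.

Lemma vabs_dist x y : vle (vabs (vabs x - vabs y)) (vabs (x - y)).
Proof.
have h (u v : X) : vle (vabs u - vabs v) (vabs (u - v)).
  have := vleDr (- vabs v) (vabsD (u - v) v).
  by rewrite subrK addrK.
by rewrite vabs_le h opprB -[vabs (x - y)]vabsN opprB h.
Qed.

(** Disjointness makes the join of |x| and |y| equal to their sum, which [vjoinE] turns into ||x| -
    |y|| = |x| + |y|. The reverse triangle inequality for x and -y then bounds this by |x + y|. *)
Lemma vabs_disjoint x y :
  vmeet (vabs x) (vabs y) = 0 -> vabs (x + y) = vabs x + vabs y.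
Proof.
move=> xy0; apply: vle_anti; first exact: vabsD.
have := vjoin_meet (vabs x) (vabs y); rewrite xy0 addr0.
rewrite vjoinE => /(congr1 ( *:%R (2 : R))).
rewrite scalerA mulfV ?pnatr_eq0// scale1r scaler_nat mulr2n => /addrI <-.
by rewrite -[vabs y]vabsN -{2}[y]opprK; exact: vabs_dist.
Qed.

Lemma band_projection_vabs (P : X -> X) x :
  is_band_projection P -> P (vabs x) = vabs (P x).
Proof.
move=> [Y [Yband Ydec PE]]; have [y [z [Yy Yz ->]]] := Ydec x.
have yz0 : vmeet (vabs y) (vabs z) = 0 by rewrite vmeetC; exact: Yz.
(* What remains is that |y| lies in the band, by solidity, and that |z| is still disjoint from
   it. *)
rewrite vabs_disjoint// !PE//.
  by apply: band_solid Yy => //; rewrite vabs_vabs vle_refl.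
by move=> u Yu; rewrite vabs_vabs; exact: Yz.
Qed.

End VectorLatticeTheory.

Lemma norm_vabs (R : realType) (X : normedLatticeType R) (x : X) :
  `|vabs x| = `|x|.
Proof.
by apply/eqP; rewrite eq_le !norm_le_vabs// vabs_vabs vle_refl.
Qed.

(** * Bounded martingales in epsilon form and their closure properties *)

Section BoundedMartingales.
Context (R : realType) (X : normedLatticeType R).
Implicit Types (E : nat -> {linear X -> X}) (x y z : nat -> X).

Lemma sup_norm_leP x (c : R) :
  (sup_norm x <= c%:E)%E <-> forall n, `|x n| <= c.
Proof.
split=> [xc n|xc].
  by rewrite -lee_fin (le_trans _ xc)//; apply: ereal_sup_ubound; exists n.
by apply: ge_ereal_sup => _ [n _ <-]; rewrite lee_fin.
Qed.

Lemma sup_norm_ge0 x : (0 <= sup_norm x)%E.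
Proof.
apply: (@le_trans _ _ (`|x 0%N|)%:E); first by rewrite lee_fin.
by apply: ereal_sup_ubound; exists 0%N.
Qed.

Lemma sup_norm_fin x : (sup_norm x < +oo)%E -> sup_norm x \is a fin_num.
Proof. by move=> ?; rewrite ge0_fin_numE// sup_norm_ge0. Qed.

Lemma sup_norm_ltyP x :
  (sup_norm x < +oo)%E <-> exists c, forall n, `|x n| <= c.
Proof.
split=> [/sup_norm_fin xfin|[c /sup_norm_leP xc]].
  by exists (fine (sup_norm x)); apply/sup_norm_leP; rewrite fineK.
by rewrite (le_lt_trans xc)// ltry.
Qed.

Lemma martingaleP E x : is_martingale E x <->
  forall e, 0 < e ->
    exists N, forall n m, (N <= n <= m)%N -> `|E n (x m) - x n| <= e.
Proof.
pose u n := ereal_sup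
  [set (`|E n (x m) - x n|)%:E | m in [set m | (n <= m)%N]].
have u_le n e : (u n <= e%:E)%E <->
    forall m, (n <= m)%N -> `|E n (x m) - x n| <= e.
  split=> [une m nm|h].
    by rewrite -lee_fin (le_trans _ une)//; apply: ereal_sup_ubound; exists m.
  by apply: ge_ereal_sup => _ [m nm <-]; rewrite lee_fin h.
(* The index m = n shows that the set is nonempty, so its supremum is not [-oo]. *)
have u_ge0 n : (0 <= u n)%E.
  apply: (@le_trans _ _ (`|E n (x n) - x n|)%:E); first by rewrite lee_fin.
  by apply: ereal_sup_ubound; exists n => //=.
rewrite /is_martingale -/u; split=> [/fine_cvgP[ufin ucvg] e e0|h].
  move/cvgrPdist_le: ucvg => /(_ e e0) ue.
  have [N _ NP] : \forall n \near \oo, (u n <= e%:E)%E.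
    near=> n; rewrite -[u n]fineK; last by near: n.
    rewrite lee_fin (le_trans (ler_norm _))// -normrN -sub0r.
    by near: n.
  by exists N => n m /andP[Nn nm]; move/(u_le n e): (NP n Nn); exact.
have ue e : 0 < e -> \forall n \near \oo, (u n <= e%:E)%E.
  move=> /h[N NP]; exists N => //= n Nn; apply/u_le => m nm.
  by apply: NP; rewrite Nn.
(* The suprema may be infinite for small n; the tolerance 1 makes them eventually finite. *)
have ufin : \forall n \near \oo, u n \is a fin_num.
  near=> n; rewrite ge0_fin_numE//; apply: (@le_lt_trans _ _ 1%:E).
    by near: n; exact: ue.
  exact: ltry.
apply/fine_cvgP; split => //; apply/cvgrPdist_le => e e0; near=> n.
rewrite /= sub0r normrN ger0_norm ?fine_ge0// -lee_fin fineK; last by near: n.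
by near: n; exact: ue.
Unshelve. all: by end_near. Qed.

(** A single epsilon argument serving both linear combinations and, with the zero martingale as [x],
    the modulus. *)
Lemma bounded_martingale_dom E (a : R) x y z :
    (forall n, `|z n| <= `|a| * `|x n| + `|y n|) ->
    (forall n m, `|E n (z m) - z n| <=
      `|a| * `|E n (x m) - x n| + `|E n (y m) - y n|) ->
  bounded_martingale E x -> bounded_martingale E y -> bounded_martingale E z.
Proof.
move=> z_le Ez_le [/martingaleP xM /sup_norm_ltyP[c xc]].
move=> [/martingaleP yM /sup_norm_ltyP[d yd]]; split; last first.
  apply/sup_norm_ltyP; exists (`|a| * c + d) => n.
  by rewrite (le_trans (z_le n))// lerD// ler_wpM2l.
apply/martingaleP => e e0.
(* Dividing by |a| + 1 instead of |a| also covers a = 0. *)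
have a1 : 0 < `|a| + 1 by rewrite ltr_wpDl.
have [|N NP] := xM (e / 2 / (`|a| + 1)); first by rewrite !divr_gt0.
have [|K KP] := yM (e / 2); first by rewrite divr_gt0.
exists (maxn N K) => n m /andP[]; rewrite geq_max => /andP[Nn Kn] nm.
rewrite (le_trans (Ez_le n m))// [leRHS]splitr lerD ?KP ?Kn//.
apply: (@le_trans _ _ ((`|a| + 1) * (e / 2 / (`|a| + 1)))).
  by rewrite ler_pM ?lerDl ?NP ?Nn.
by rewrite mulrC divfK// gt_eqF.
Qed.

Lemma bounded_martingale0 E : bounded_martingale E (fun=> 0).
Proof.
split; last by apply/sup_norm_ltyP; exists 0 => n; rewrite normr0.
apply/martingaleP => e e0; exists 0%N => n m _.
by rewrite linear0 subrr normr0 ltW.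
Qed.

Lemma bounded_martingale_lin E (a : R) x y :
  bounded_martingale E x -> bounded_martingale E y ->
  bounded_martingale E (fun n => a *: x n + y n).
Proof.
apply: (@bounded_martingale_dom E a) => [n|n m].
  by rewrite -normrZ ler_normD.
by rewrite linearP opprD addrACA -scalerBr -normrZ ler_normD.
Qed.

Lemma bounded_martingale_vabs E x : (forall n, is_band_projection (E n)) ->
  bounded_martingale E x -> bounded_martingale E (fun n => vabs (x n)).
Proof.
move=> Eband xM.
apply: (@bounded_martingale_dom E 1) (bounded_martingale0 E) xM.
  by move=> n; rewrite normr0 mulr0 add0r norm_vabs.
move=> n m; rewrite linear0 subrr normr0 mulr0 add0r band_projection_vabs//.
exact/norm_le_vabs/vabs_dist.
Qed.

End BoundedMartingales.

(** * The vector space of bounded martingales *)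

Section MartingaleLattice.
Context (R : realType) (X : banachLatticeType R) (E : nat -> {linear X -> X}).

(* The hypotheses are arguments of the type, so that instances depending on
   them can be declared on it. *)
Definition mart_lattice (Efilt : is_contractive_filtration E)
  (Eband : forall n, is_band_projection (E n)) : Type := martingale_space E.

Context (Efilt : is_contractive_filtration E).
Context (Eband : forall n, is_band_projection (E n)).

Local Notation M := (mart_lattice Efilt Eband).
Implicit Types (A B C : M) (a : R).

HB.instance Definition _ := gen_eqMixin M.
HB.instance Definition _ := gen_choiceMixin M.

Definition mart x (xM : bounded_martingale E x) : M := exist _ x (mem_set xM).

Definition mseq A : nat -> X := mart_seq (A : martingale_space E).

Lemma mseq_bounded_martingale A : bounded_martingale E (mseq A).
Proof. exact/set_mem/(valP (A : martingale_space E)). Qed.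

(** Membership proofs are irrelevant, so each algebraic law reduces to the same law of [X] in every
    coordinate. *)
Lemma mseq_inj A B : (forall n, mseq A n = mseq B n) -> A = B.
Proof. by move=> AB; apply: val_inj; exact/funext. Qed.

Definition mart0 := mart (bounded_martingale0 E).

(** Sum, opposite and scaling are all instances of this operation, so one closure lemma suffices. *)
Definition mart_lin a A B : M := mart (bounded_martingale_lin a
  (mseq_bounded_martingale A) (mseq_bounded_martingale B)).

Definition mart_add A B := mart_lin 1 A B.
Definition mart_opp A := mart_lin (- 1) A mart0.
Definition mart_scale a A := mart_lin a A mart0.

Lemma mart_addE A B n : mseq (mart_add A B) n = mseq A n + mseq B n.
Proof. by rewrite /mseq/mart_seq/= scale1r. Qed.

Lemma mart_oppE A n : mseq (mart_opp A) n = - mseq A n.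
Proof. by rewrite /mseq/mart_seq/= addr0 scaleN1r. Qed.

Lemma mart_scaleE a A n : mseq (mart_scale a A) n = a *: mseq A n.
Proof. by rewrite /mseq/mart_seq/= addr0. Qed.

Fact mart_addA : associative mart_add.
Proof. by move=> A B C; apply: mseq_inj => n; rewrite !mart_addE addrA. Qed.

Fact mart_addC : commutative mart_add.
Proof. by move=> A B; apply: mseq_inj => n; rewrite !mart_addE addrC. Qed.

Fact mart_add0 : left_id mart0 mart_add.
Proof. by move=> A; apply: mseq_inj => n; rewrite mart_addE add0r. Qed.

Fact mart_addN : left_inverse mart0 mart_opp mart_add.
Proof.
by move=> A; apply: mseq_inj => n; rewrite mart_addE mart_oppE addNr.
Qed.

HB.instance Definition _ :=
  GRing.isZmodule.Build M mart_addA mart_addC mart_add0 mart_addN.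

Lemma mseqD A B n : mseq (A + B) n = mseq A n + mseq B n.
Proof. exact: mart_addE. Qed.

Lemma mseqN A n : mseq (- A) n = - mseq A n.
Proof. exact: mart_oppE. Qed.

Fact mart_scaleA a b A : mart_scale a (mart_scale b A) = mart_scale (a * b) A.
Proof. by apply: mseq_inj => n; rewrite !mart_scaleE scalerA. Qed.

Fact mart_scale1 : left_id 1 mart_scale.
Proof. by move=> A; apply: mseq_inj => n; rewrite mart_scaleE scale1r. Qed.

Fact mart_scaleDr : right_distributive mart_scale +%R.
Proof.
by move=> a A B; apply: mseq_inj => n; rewrite !(mseqD, mart_scaleE) scalerDr.
Qed.

Fact mart_scaleDl A : {morph mart_scale^~ A : a b / a + b}.
Proof.
by move=> a b; apply: mseq_inj => n; rewrite !(mseqD, mart_scaleE) scalerDl.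
Qed.

HB.instance Definition _ := GRing.Zmodule_isLmodule.Build R M
  mart_scaleA mart_scale1 mart_scaleDr mart_scaleDl.

Lemma mseqZ a A n : mseq (a *: A) n = a *: mseq A n.
Proof. exact: mart_scaleE. Qed.

(** * The supremum norm *)

Definition mart_norm A : R := fine (sup_norm (mseq A)).

(** Boundedness makes the supremum finite, so [fine] loses nothing. *)
Lemma mart_normE A : (mart_norm A)%:E = sup_norm (mseq A).
Proof. by rewrite fineK// sup_norm_fin// (mseq_bounded_martingale A).2. Qed.

Lemma mart_norm_leP A c : mart_norm A <= c <-> forall n, `|mseq A n| <= c.
Proof. by rewrite -lee_fin mart_normE; exact: sup_norm_leP. Qed.

Lemma mart_norm_ub A n : `|mseq A n| <= mart_norm A.
Proof. by move: n; exact/mart_norm_leP. Qed.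

Fact mart_normD A B : mart_norm (A + B) <= mart_norm A + mart_norm B.
Proof.
apply/mart_norm_leP => n.
by rewrite mseqD (le_trans (ler_normD _ _))// lerD// mart_norm_ub.
Qed.

Fact mart_normZ a A : mart_norm (a *: A) = `|a| * mart_norm A.
Proof.
have le_normZ b B : mart_norm (b *: B) <= `|b| * mart_norm B.
  by apply/mart_norm_leP => n; rewrite mseqZ normrZ ler_wpM2l// mart_norm_ub.
have [->|a0] := eqVneq a 0.
  apply/eqP; rewrite eq_le le_normZ normr0 mul0r.
  exact: le_trans (mart_norm_ub _ 0%N).
(* The reverse inequality is [le_normZ] for the scalar a^-1 and the martingale a A. *)
apply/eqP; rewrite eq_le le_normZ /= -{1}(scalerK a0 A).
by rewrite -ler_pdivlMl ?normr_gt0// -normfV le_normZ.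
Qed.

Fact mart_norm0_eq0 A : mart_norm A = 0 -> A = 0.
Proof.
move=> A0; apply: mseq_inj => n; apply/normr0_eq0/le_anti.
by rewrite normr_ge0 -A0 mart_norm_ub.
Qed.

HB.instance Definition _ :=
  Lmodule_isNormed.Build R M mart_normD mart_normZ mart_norm0_eq0.

Lemma mnorm_leP A c : `|A| <= c <-> forall n, `|mseq A n| <= c.
Proof. exact: mart_norm_leP. Qed.

Lemma mnorm_ub A n : `|mseq A n| <= `|A|.
Proof. exact: mart_norm_ub. Qed.

Lemma mseq_dist A B n : `|mseq A n - mseq B n| <= `|A - B|.
Proof. by rewrite -mseqN -mseqD mnorm_ub. Qed.

(** * Completeness *)

Fact mart_complete (F : set_system M) : ProperFilter F -> cauchy F -> cvg F.
Proof.
move=> FF /cauchyP Fcauchy.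
have Fex e : 0 < e -> exists A, \forall B \near F, `|A - B| <= e.
  move=> e0; have [A FA] := Fcauchy e e0.
  by exists A; apply: filterS FA => B; rewrite -ball_normE => /ltW.
(* Each coordinate is 1-Lipschitz, so it sends [F] to a Cauchy filter on the complete space [X]; [x]
   collects the limits. *)
have /choice[x xlim] n : exists l : X, (fun A => mseq A n) @ F --> l.
  apply/cvg_ex/cauchy_cvgP/cauchy_exP => e e0.
  have [|A FA] := Fex (e / 2); first exact: divr_gt0.
  exists (mseq A n); apply: filterS FA => B AB.
  rewrite -ball_normE /= (le_lt_trans (mseq_dist _ _ _))//.
  by rewrite (le_lt_trans AB)// ltr_pdivrMr// ltr_pMr// ltr1n.
(* The approximation is uniform in n: [A] is chosen before n, and only the intermediate [B], near
   [A] in norm and near [x] in coordinate n, depends on n. *)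
have xapprox e : 0 < e -> exists A,
    (forall n, `|mseq A n - x n| <= e) /\ \forall B \near F, `|A - B| <= e.
  move=> e0; have [|A FA] := Fex (e / 2); first exact: divr_gt0.
  exists A; split=> [n|]; last first.
    apply: filterS FA => B /le_trans; apply.
    by rewrite ler_pdivrMr// ler_pMr// ler1n.
  have /cvgrPdist_le/(_ (e / 2) (divr_gt0 e0 (ltr0Sn _ 1))) Fx := xlim n.
  have [B [AB xB]] : exists B, `|A - B| <= e / 2 /\ `|x n - mseq B n| <= e / 2.
    exact: filter_ex (filterI FA Fx).
  rewrite -(subrKA (mseq B n)) (le_trans (ler_normD _ _))// [leRHS]splitr.
  by rewrite lerD ?(le_trans (mseq_dist _ _ _))// distrC.
have xM : bounded_martingale E x.
  split.
    apply/martingaleP => e e0; have e3 : 0 < e / 3 by exact: divr_gt0.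
    have [A [Ax _]] := xapprox _ e3.
    have [N NP] := (martingaleP _ _).1 (mseq_bounded_martingale A).1 _ e3.
    exists N => n m /NP Anm.
    (* Three terms of size e / 3: the first by contractivity of [E n], the second by the martingale
       property of [A], the third by the choice of [A]. *)
    have -> : E n (x m) - x n =
        - E n (mseq A m - x m) + (E n (mseq A m) - mseq A n) + (mseq A n - x n).
      by rewrite linearB opprB !addrA !subrK.
    have -> : e = e / 3 + e / 3 + e / 3 by field.
    rewrite (le_trans (ler_normD _ _))// lerD// (le_trans (ler_normD _ _))//.
    by rewrite lerD// normrN (le_trans (filtration_contractive Efilt _ _)).
  apply/sup_norm_ltyP; have [A [Ax _]] := xapprox 1 ltr01.
  exists (1 + `|A|) => n; rewrite -[x n](subrK (mseq A n)).
  by rewrite (le_trans (ler_normD _ _))// lerD ?mnorm_ub// distrC.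
apply/cvg_ex; exists (mart xM); apply/cvgrPdist_le => e e0.
(* [A] is within e / 2 of [x] in all coordinates and of every [B] near [F], which gives convergence
   in norm. *)
have [|A [Ax FA]] := xapprox (e / 2); first exact: divr_gt0.
apply: filterS FA => B AB; apply/mnorm_leP => n.
rewrite mseqD mseqN (_ : mseq (mart xM) n = x n)//.
rewrite -(subrKA (mseq A n)) (le_trans (ler_normD _ _))// [leRHS]splitr.
by rewrite lerD ?(le_trans (mseq_dist _ _ _))// distrC.
Qed.

HB.instance Definition _ := Uniform_isComplete.Build M mart_complete.

(** * Coordinate-wise order and lattice operations *)

Fact mart_vabs_bounded A : bounded_martingale E (fun n => vabs (mseq A n)).
Proof. exact/bounded_martingale_vabs/mseq_bounded_martingale. Qed.

Fact mart_join_bounded A B :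
  bounded_martingale E (fun n => vjoin (mseq A n) (mseq B n)).
Proof.
pose C : M := 2^-1 *: (A + B + mart (mart_vabs_bounded (A - B))).
rewrite (_ : (fun n => _) = mseq C); first exact: mseq_bounded_martingale.
apply/funext => n; rewrite vjoinE mseqZ !mseqD.
by rewrite (_ : mseq (mart _) n = vabs (mseq (A - B) n))// mseqD mseqN.
Qed.

Definition mart_join A B := mart (mart_join_bounded A B).
(** Obtained by duality, so that closure under joins already gives a bounded martingale. *)
Definition mart_meet A B : M := - mart_join (- A) (- B).
Definition mart_le A B := `[< forall n, vle (mseq A n) (mseq B n) >].

Lemma mart_joinE A B n : mseq (mart_join A B) n = vjoin (mseq A n) (mseq B n).
Proof. by []. Qed.

Lemma mart_meetE A B n : mseq (mart_meet A B) n = vmeet (mseq A n) (mseq B n).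
Proof. by rewrite mseqN mart_joinE !mseqN vmeetN. Qed.

Fact mart_le_refl : reflexive mart_le.
Proof. by move=> A; apply/asboolP => n; exact: vle_refl. Qed.

Fact mart_le_anti : antisymmetric mart_le.
Proof.
move=> A B /andP[/asboolP AB /asboolP BA].
by apply: mseq_inj => n; exact: vle_anti.
Qed.

Fact mart_le_trans : transitive mart_le.
Proof.
move=> B A C /asboolP AB /asboolP BC.
by apply/asboolP => n; exact: vle_trans (BC n).
Qed.

Fact mart_lexI A B C : mart_le A (mart_meet B C) = mart_le A B && mart_le A C.
Proof.
apply/asboolP/andP => [h|[/asboolP AB /asboolP AC] n].
  split; apply/asboolP => n; have := h n;
    by rewrite mart_meetE vlexI => /andP[].
by rewrite mart_meetE vlexI AB AC.
Qed.

Fact mart_leUx A B C : mart_le (mart_join A B) C = mart_le A C && mart_le B C.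
Proof.
apply/asboolP/andP => [h|[/asboolP AC /asboolP BC] n].
  by split; apply/asboolP => n; have := h n; rewrite vleUx => /andP[].
by rewrite mart_joinE vleUx AC BC.
Qed.

(* The order lives on a copy of M, as M may not carry both an order and a
   module structure. *)
Definition mart_order : Type := M.
HB.instance Definition _ := Choice.on mart_order.
HB.instance Definition _ := @Order.Le_isPOrder.Build ring_display mart_order
  mart_le mart_le_refl mart_le_anti mart_le_trans.
HB.instance Definition _ := @Order.POrder_MeetJoin_isLattice.Build ring_display
  mart_order mart_meet mart_join mart_lexI mart_leUx.

Fact mart_leD A B C : mart_le A B -> mart_le (A + C) (B + C).
Proof.
by move=> /asboolP AB; apply/asboolP => n; rewrite !mseqD; exact: vleDr.
Qed.

Fact mart_leZ a A B : 0 <= a -> mart_le A B -> mart_le (a *: A) (a *: B).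
Proof.
by move=> a0 /asboolP AB; apply/asboolP => n; rewrite !mseqZ; exact: vleZ.
Qed.

HB.instance Definition _ := @Lmodule_isVectorLattice.Build R M
  (Order.Lattice.class mart_order) mart_leD mart_leZ.

Lemma mseq_vabs A n : mseq (vabs A) n = vabs (mseq A n).
Proof. by rewrite /vabs -mseqN. Qed.

Fact mart_norm_le_vabs A B : vle (vabs A) (vabs B) -> `|A| <= `|B|.
Proof.
move=> /asboolP AB; apply/mnorm_leP => n; apply: le_trans (mnorm_ub B n).
by apply: norm_le_vabs; rewrite -!mseq_vabs.
Qed.

HB.instance Definition _ :=
  NormedModule_isNormedLattice.Build R M mart_norm_le_vabs.

End MartingaleLattice.

Theorem proposition11 (R : realType) (X : banachLatticeType R)
    (E : nat -> {linear X -> X}) :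
  is_contractive_filtration E ->
  (forall n, is_band_projection (E n)) ->
  exists s : banach_lattice_on R (martingale_space E),
    let M : banachLatticeType R := BanachLattice.Pack s in
    (forall (A B : M) n, mart_seq (A + B) n = mart_seq A n + mart_seq B n) /\
    (forall (a : R) (A : M) n, mart_seq (a *: A) n = a *: mart_seq A n) /\
    (forall A : M, (`|A|)%:E = sup_norm (mart_seq A)) /\
    (forall A B : M, vle A B <-> forall n, vle (mart_seq A n) (mart_seq B n)) /\
    (forall (A B : M) n, mart_seq (vjoin A B) n = vjoin (mart_seq A n) (mart_seq B n)) /\
    (forall (A B : M) n, mart_seq (vmeet A B) n = vmeet (mart_seq A n) (mart_seq B n)) /\
    (forall (A : M) n, mart_seq (vabs A) n = vabs (mart_seq A n)).
Proof.
move=> Efilt Eband.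
(* [mart_lattice Efilt Eband] unfolds to [martingale_space E], so its structure is one on the
   required carrier. *)
exists (BanachLattice.class (mart_lattice Efilt Eband)) => M.
split; first exact: mseqD.
split; first exact: mseqZ.
split; first exact: mart_normE.
split; first by move=> A B; split => /asboolP.
split; first exact: mart_joinE.
split; first exact: mart_meetE.
exact: mseq_vabs.
Qed.
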